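(* Let $n\in\mathbb{N}$. If $f\in C[0,\infty)$ is a (real-valued) convex function of polynomial growth, then $$\sum_{i=0}^{\infty}\sum_{j=0}^{\infty}\left[ b_{n,i}(x)\,b_{n,j}(x)+b_{n,i}(y)\,b_{n,j}(y)-2\,b_{n,i}(x)\,b_{n,j}(y)\right] f(i+j)\geq 0$$ for all $x,y\in[0,\infty)$.
   Context: $\mathbb{N}=\{1,2,3,\ldots\}$. For $n\in\mathbb{N}$, $\nu=0,1,2,\ldots$ and $x\in[0,\infty)$, the Baskakov basis functions are $b_{n,\nu}(x)=\binom{n+\nu-1}{\nu}\frac{x^{\nu}}{(1+x)^{n+\nu}}$ (with the convention $0^0=1$). $C[0,\infty)$ denotes the continuous real-valued functions on $[0,\infty)$. A function $f$ on $[0,\infty)$ is of polynomial growth if there are constants $C\ge 0$ and $m\in\mathbb{N}$ such that $|f(t)|\le C(1+t)^m$ for all $t\ge 0$. *)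

(* Defs.v *)
From mathcomp Require Import all_boot all_order all_algebra.
From mathcomp Require Import all_classical all_reals all_analysis.

Set Implicit Arguments.
Unset Strict Implicit.
Unset Printing Implicit Defensive.

Import Order.TTheory GRing.Theory Num.Theory.
Import numFieldNormedType.Exports.

Local Open Scope classical_set_scope.
Local Open Scope ring_scope.

(* The subtraction in the binomial is truncated; for [0 < n] it agrees with the
   usual one.  [0 ^+ 0 = 1] holds by the definition of [^+]. *)
Definition baskakov (R : realType) (n v : nat) (x : R) : R :=
  'C(n + v - 1, v)%:R * (x ^+ v / (1 + x) ^+ (n + v)).

Definition polynomial_growth (R : realType) (f : R -> R) : Prop :=
  exists (C : R) (m : nat), [/\ 0 <= C, (0 < m)%N &
    forall t : R, 0 <= t -> `|f t| <= C * (1 + t) ^+ m].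

Definition baskakov_term (R : realType) (n : nat) (f : R -> R) (x y : R)
    (i j : nat) : R :=
  (baskakov n i x * baskakov n j x + baskakov n i y * baskakov n j y
   - 2%:R * baskakov n i x * baskakov n j y) * f ((i + j)%:R).

(* [limn] returns an arbitrary value on a divergent sequence, so a claim about
   [iterated_sum a] is meaningful only together with
   [iterated_summable a]. *)
Definition iterated_sum (R : realType) (a : nat -> nat -> R) : R :=
  limn (series (fun i => limn (series (a i)))).

Definition iterated_summable (R : realType) (a : nat -> nat -> R) : Prop :=
  (forall i, cvgn (series (a i))) /\
  cvgn (series (fun i => limn (series (a i)))).

(* Main.v *)
(** Put [d i = b_{n,i}(x) - b_{n,i}(y)], [D N = \sum_(k < N) d k] and [g i = f i].
    Since [g (i + j)] is symmetric, the square partial sums of the double series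
    are [\sum_(i, j < N) d i * d j * g (i + j)].  Summation by parts in both
    indices turns them into
    [\sum_(i, j < N) D i.+1 * D j.+1 * (g (i+j) - 2 g (i+j+1) + g (i+j+2))]
    plus boundary terms containing a factor [D N].  With [u = x / (1 + x)], the
    sum of [b_{n,k}(x)] over [k < N] is the polynomial
    [\sum_(k < N) C(n+k-1, k) u^k (1 - u)^n], whose derivative
    [- N C(n+N-1, N) u^(N-1) (1-u)^(n-1)] is nonpositive and geometrically small
    in [N].  So all the [D N] have the same sign, and they beat any polynomial
    growth of [g]: the main sum is nonnegative and the boundary terms vanish. *)
Require Import Defs.
From mathcomp Require Import all_boot all_order all_algebra.
From mathcomp Require Import all_classical all_reals all_analysis.
From mathcomp Require Import ring lra zify.
Set Implicit Arguments.
Unset Strict Implicit.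
Unset Printing Implicit Defensive.
Import Order.TTheory GRing.Theory Num.Theory.
Import numFieldNormedType.Exports.
Local Open Scope classical_set_scope.
Local Open Scope ring_scope.

(** * Geometrically dominated series and double series *)

Lemma sum_expr_le (R : realType) (s : R) (N n : nat) :
  0 <= s < 1 -> (N <= n)%N -> \sum_(N <= k < n) s ^+ k <= s ^+ N / (1 - s).
Proof.
move=> /andP[s0 s1] Nn; rewrite ler_pdivlMr ?subr_gt0// mulr_suml.
rewrite (eq_bigr (fun k => - s ^+ k.+1 - (- s ^+ k))); last first.
  by move=> k _; rewrite exprS; ring.
by rewrite (telescope_sumr (fun k => - s ^+ k))// opprK gerDr oppr_le0 exprn_ge0.
Qed.

(** The remainder inherits the geometric tail bound; at [N = 0] this bounds the sum itself. *)
Lemma geometric_dominated_series (R : realType) (u : nat -> R) (M s : R) :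
  0 <= s < 1 -> (forall k, `|u k| <= M * s ^+ k) ->
  cvgn (series u) /\
  forall N, `|limn (series u) - series u N| <= M * s ^+ N / (1 - s).
Proof.
move=> s01 uM; have /andP[s0 s1] := s01.
have M0 : 0 <= M.
  by have := uM 0%N; rewrite expr0 mulr1; apply: le_trans; exact: normr_ge0.
have cu : cvgn (series u).
  apply: normed_cvg; apply: (@series_le_cvg _ _ (geometric M s)) => //.
  - by move=> k; exact: normr_ge0.
  - by move=> k /=; rewrite mulr_ge0 ?exprn_ge0.
  - by apply: is_cvg_geometric_series; rewrite ger0_norm.
split=> // N.
have cN : `|series u n - series u N| @[n --> \oo] -->
          `|limn (series u) - series u N|.
  by apply: cvg_norm; apply: cvgB => //; exact: cvg_cst.
apply: (cvgr_to_le cN).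
exists N => // n /= Nn; rewrite sub_series_geq//.
apply: (le_trans (ler_norm_sum _ _ _)).
apply: (@le_trans _ _ (\sum_(N <= k < n) M * s ^+ k)); first exact: ler_sum.
by rewrite -mulr_sumr -mulrA ler_wpM2l// sum_expr_le.
Qed.

(** The first [N] row sums differ from the square sum by [N] row tails, the [i]-th at most
    [M * s ^+ N / (1 - s) * s ^+ i]; added up, they are still of order [s ^+ N]. *)
Lemma cvg_squares_iterated_sum (R : realType) (a : nat -> nat -> R) (M s : R) :
  0 <= s < 1 -> (forall i j, `|a i j| <= M * s ^+ i * s ^+ j) ->
  iterated_summable a /\
  \sum_(0 <= i < N) \sum_(0 <= j < N) a i j @[N --> \oo] --> iterated_sum a.
Proof.
move=> s01 aM; have /andP[s0 s1] := s01.
have M0 : 0 <= M.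
  by have := aM 0%N 0%N; rewrite expr0 !mulr1; apply: le_trans; exact: normr_ge0.
have row i := @geometric_dominated_series _ (a i) _ _ s01 (aM i).
pose r i := limn (series (a i)).
have rM i : `|r i| <= M / (1 - s) * s ^+ i.
  have [_ /(_ 0%N)] := row i.
  rewrite /series /= big_geq// subr0 expr0 mulr1.
  by rewrite mulrAC.
have [cr _] := @geometric_dominated_series _ r _ _ s01 rM.
split; first by split=> // i; case: (row i).
pose E N := series r N - \sum_(0 <= i < N) \sum_(0 <= j < N) a i j.
have E0 : E N @[N --> \oo] --> 0.
  apply/norm_cvg0P.
  apply: (@squeeze_cvgr _ _ _ _ (cst 0) (geometric (M / (1 - s) / (1 - s)) s)).
  - apply: nearW => N /=; rewrite normr_ge0/= /E /series /= -sumrB.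
    apply: (le_trans (ler_norm_sum _ _ _)).
    apply: (@le_trans _ _ (\sum_(0 <= i < N) M * s ^+ N / (1 - s) * s ^+ i)).
      apply: ler_sum => i _; have [_ /(_ N)] := row i; rewrite /r.
      by move=> /le_trans; apply; rewrite [leLHS](_ : _ = M * s ^+ N / (1 - s) * s ^+ i)//; ring.
    rewrite -mulr_sumr; apply: (@le_trans _ _ (M * s ^+ N / (1 - s) * (1 / (1 - s)))).
      rewrite ler_wpM2l//; last by rewrite -(expr0 s) sum_expr_le.
      by rewrite divr_ge0 ?mulr_ge0 ?exprn_ge0// subr_ge0 ltW.
    by rewrite [leLHS](_ : _ = M / (1 - s) / (1 - s) * s ^+ N)//; ring.
  - exact: cvg_cst.
  - by apply: cvg_geometric; rewrite ger0_norm.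
have -> : (fun N => \sum_(0 <= i < N) \sum_(0 <= j < N) a i j) =
          (fun N => series r N - E N).
  by apply/funext => N; rewrite /E opprB addrC subrK.
by rewrite -[iterated_sum a]subr0; apply: cvgB.
Qed.

(** * Summation by parts and the inequality for abstract sequences *)

(** Taking the boundary term at [h N] rather than [h N.-1] makes the identity hold from [N = 0]
    on. *)
Lemma sum_by_parts (R : realType) (d h : nat -> R) (N : nat) :
  \sum_(0 <= j < N) d j * h j =
  series d N * h N + \sum_(0 <= j < N) series d j.+1 * (h j - h j.+1).
Proof.
elim: N => [|N IH]; first by rewrite /series /= !big_geq// mul0r addr0.
rewrite big_nat_recr//= IH [in RHS]big_nat_recr//=.
have -> : series d N.+1 = series d N + d N by rewrite /series /= big_nat_recr.
move: (series d N) (\sum_(0 <= j < N) _) => S A; ring.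
Qed.

(** The weights [v] and [w] carry the growth of [g]; each is absorbed by the decay of one factor. *)
Lemma ler_norm_weighted (R : realType) (p q g v w C P Q : R) :
  0 <= C -> 0 <= v -> 0 <= w -> `|p| * v <= P -> `|q| * w <= Q ->
  `|g| <= C * v * w -> `|p * q * g| <= C * P * Q.
Proof.
move=> C0 v0 w0 pP qQ gC; rewrite !normrM.
apply: (@le_trans _ _ (`|p| * `|q| * (C * v * w))).
  by rewrite ler_wpM2l// mulr_ge0.
rewrite [leLHS](_ : _ = C * ((`|p| * v) * (`|q| * w))); last by ring.
by rewrite -(mulrA C P) ler_wpM2l// ler_pM// mulr_ge0.
Qed.

(** Summation by parts in [j], then in [i] on the part free of [D N]. The second boundary sum keeps
    the two values of [g] apart so that each product can be bounded separately. *)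
Lemma sum_convolution_by_parts (R : realType) (d g : nat -> R) (N : nat) :
  let D := series d in
  \sum_(0 <= i < N) \sum_(0 <= j < N) d i * d j * g (i + j)%N =
  \sum_(0 <= i < N) D N * d i * g (i + N)%N
  + \sum_(0 <= j < N) (D j.+1 * D N * g (j + N)%N - D j.+1 * D N * g (j.+1 + N)%N)
  + \sum_(0 <= j < N) \sum_(0 <= i < N)
      D j.+1 * D i.+1 * (g (i + j)%N - 2 * g (i + j).+1 + g (i + j).+2).
Proof.
move=> D.
under eq_bigr => i _.
  under eq_bigr => j _ do rewrite -mulrA.
  rewrite -mulr_sumr (sum_by_parts d (fun j => g (i + j)%N)) mulrDr mulr_sumr.
  over.
rewrite big_split /=; rewrite -addrA; congr (_ + _).
  by apply: eq_bigr => i _; rewrite mulrA (mulrC (d i)).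
rewrite exchange_big/= -big_split /=; apply: eq_bigr => j _.
under eq_bigr => i _ do rewrite mulrCA.
rewrite -mulr_sumr.
rewrite (sum_by_parts d (fun i => g (i + j)%N - g (i + j.+1)%N)) mulrDr; congr (_ + _).
  by rewrite (addnC j) (addnC j.+1) /D; ring.
rewrite mulr_sumr; apply: eq_bigr => i _.
by rewrite -mulrA addnS !addSn addnS /D; congr (_ * (_ * _)); ring.
Qed.

(** The decay of [D] is a separate hypothesis because the bounds on [a] and [b] do not force their
    partial sums to agree in the limit. *)
Lemma iterated_sum_square_ge0 (R : realType) (a b g w : nat -> R) (C K s : R) :
  0 <= s < 1 -> 0 <= C ->
  (forall i, 0 <= w i) -> (forall i, w i <= w i.+1) ->
  (forall i, `|a i| * w i <= K * s ^+ i) ->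
  (forall i, `|b i| * w i <= K * s ^+ i) ->
  let D := series (fun i => a i - b i) in
  (forall N, `|D N| * w N <= K * s ^+ N) ->
  (forall i j, 0 <= D i * D j) ->
  (forall i j, `|g (i + j)%N| <= C * w i * w j) ->
  (forall i, 0 <= g i - 2 * g i.+1 + g i.+2) ->
  let T i j := (a i * a j + b i * b j - 2 * a i * b j) * g (i + j)%N in
  iterated_summable T /\ 0 <= iterated_sum T.
Proof.
move=> s01 C0 w0 w_nd aK bK D DK DD gC g_cvx T; have /andP[s0 s1] := s01.
have K0 : 0 <= K.
  by have := aK 0%N; rewrite expr0 mulr1; apply: le_trans; rewrite mulr_ge0.
pose d i := a i - b i.
have dK i : `|d i| * w i <= 2 * K * s ^+ i.
  apply: (@le_trans _ _ ((`|a i| + `|b i|) * w i)).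
    by rewrite ler_wpM2r// ler_normB.
  by have := aK i; have := bK i; lra.
have TM i j : `|T i j| <= 4 * C * K ^+ 2 * s ^+ i * s ^+ j.
  have Haa := ler_norm_weighted C0 (w0 i) (w0 j) (aK i) (aK j) (gC i j).
  have Hbb := ler_norm_weighted C0 (w0 i) (w0 j) (bK i) (bK j) (gC i j).
  have Hab := ler_norm_weighted C0 (w0 i) (w0 j) (aK i) (bK j) (gC i j).
  rewrite (_ : T i j = a i * a j * g (i + j)%N + b i * b j * g (i + j)%N
    - 2 * (a i * b j * g (i + j)%N)); last by rewrite /T; ring.
  apply: (le_trans (ler_normB _ _)); apply: (le_trans (lerD (ler_normD _ _) (lexx _))).
  rewrite (normrM 2) (ger0_norm (ler0n _ 2)).
  rewrite (_ : 4 * _ * _ * _ * _ = 4 * (C * (K * s ^+ i) * (K * s ^+ j))); last by ring.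
  by lra.
have [Tsum Tcvg] := cvg_squares_iterated_sum s01 TM.
split=> //.
(* The summands differ by [(b i * a j - a i * b j) * g (i + j)], antisymmetric in [i] and [j]: the
   sums agree over squares, though not term by term. *)
have TE N : \sum_(0 <= i < N) \sum_(0 <= j < N) T i j =
    \sum_(0 <= i < N) \sum_(0 <= j < N) d i * d j * g (i + j)%N.
  apply/eqP; rewrite -subr_eq0 -sumrB.
  under eq_bigr => i _.
    rewrite -sumrB.
    under eq_bigr => j _.
      rewrite (_ : _ - _ = b i * a j * g (i + j)%N - a i * b j * g (i + j)%N); last first.
        by rewrite /T /d; ring.
      over.
    rewrite sumrB; over.
  rewrite sumrB [X in _ - X]exchange_big /= -sumrB big1// => i _.
  rewrite -sumrB big1// => j _; rewrite (addnC j) (mulrC (a j)) subrr//.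
(* Each of the two boundary sums costs at most [E / 2 * s ^+ N]. *)
pose E := 4 * C * K ^+ 2 / (1 - s).
have TE_ge N : - (E * s ^+ N) <= \sum_(0 <= i < N) \sum_(0 <= j < N) T i j.
  rewrite TE sum_convolution_by_parts -/D.
  have sumK : \sum_(0 <= i < N) 2 * C * K ^+ 2 * s ^+ N * s ^+ i <= E / 2 * s ^+ N.
    rewrite -mulr_sumr.
    rewrite (_ : E / 2 * s ^+ N = 2 * C * K ^+ 2 * s ^+ N * (1 / (1 - s))).
      by rewrite ler_wpM2l ?mulr_ge0 ?exprn_ge0// -(expr0 s) sum_expr_le.
    by rewrite /E; field; rewrite subr_eq0 gt_eqF.
  set B1 := (X in X + _ + _); set B2 := (X in _ + X + _); set B3 := (X in _ + _ + X).
  have B1E : `|B1| <= E / 2 * s ^+ N.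
    apply: le_trans sumK; apply: (le_trans (ler_norm_sum _ _ _)); apply: ler_sum => i _.
    have := ler_norm_weighted C0 (w0 N) (w0 i) (DK N) (dK i).
    move=> /(_ (g (i + N)%N)); rewrite addnC => /(_ (gC N i)) /le_trans; apply.
    rewrite [leLHS](_ : _ = 2 * C * K ^+ 2 * s ^+ N * s ^+ i)//; ring.
  have B2E : `|B2| <= E / 2 * s ^+ N.
    apply: le_trans sumK; apply: (le_trans (ler_norm_sum _ _ _)); apply: ler_sum => j _.
    apply: (le_trans (ler_normB _ _)).
    (* The accompanying factor is [D j.+1], so the weight is raised from [w j] to [w j.+1]. *)
    have gC' : `|g (j + N)%N| <= C * w j.+1 * w N.
      by apply: (le_trans (gC _ _)); rewrite ler_wpM2r// ler_wpM2l.
    have H1 := ler_norm_weighted C0 (w0 j.+1) (w0 N) (DK j.+1) (DK N) gC'.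
    have H2 := ler_norm_weighted C0 (w0 j.+1) (w0 N) (DK j.+1) (DK N) (gC j.+1 N).
    apply: (le_trans (lerD H1 H2)).
    rewrite [leLHS](_ : _ = 2 * C * K ^+ 2 * s ^+ N * s ^+ j.+1); last by ring.
    by rewrite ler_wpM2l ?mulr_ge0 ?exprn_ge0 // exprS ler_piMl ?exprn_ge0 // ltW.
  have B3_ge0 : 0 <= B3.
    by apply: sumr_ge0 => j _; apply: sumr_ge0 => i _; rewrite mulr_ge0.
  move: B1E B2E; rewrite !ler_norml => /andP[B1E _] /andP[B2E _].
  lra.
(* Adding [E * s ^+ N] makes every square sum nonnegative without changing the limit. *)
have cvgTE : \sum_(0 <= i < N) \sum_(0 <= j < N) T i j + E * s ^+ N @[N --> \oo]
    --> iterated_sum T + 0.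
  by apply: cvgD => //; apply: (@cvg_geometric _ E s); rewrite ger0_norm.
rewrite -[iterated_sum T]addr0; apply: (cvgr_to_ge cvgTE).
by apply: nearW => N; have := TE_ge N; lra.
Qed.

(** * Polynomial factors against geometric decay *)

(** Each factor [i.+1] is paid for by slowing the rate from [s] to the midpoint [t] of [s] and [1]:
    with [q = s / t], the powers of [q] decrease, so [i.+1 * q ^+ i] is at most their geometric
    sum. *)
Lemma natr_exp_geometric (R : realType) (p : nat) (r : R) : 0 <= r < 1 ->
  exists K s : R, [/\ 0 <= K, 0 <= s < 1 &
    forall i, i.+1%:R ^+ p * r ^+ i <= K * s ^+ i].
Proof.
move=> r01; elim: p => [|p [K [s [K0 /andP[s0 s1] IH]]]].
  by exists 1, r; split=> // i; rewrite expr0.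
pose t := (1 + s) / 2; pose q := s / t.
have t0 : 0 < t by rewrite /t; lra.
have t1 : t < 1 by rewrite /t; lra.
have q01 : 0 <= q < 1.
  apply/andP; split; first by rewrite divr_ge0// ltW.
  by rewrite ltr_pdivrMr// mul1r /t; lra.
have /andP[q0 q1] := q01.
have q_le i : i.+1%:R * q ^+ i <= (1 - q)^-1.
  have := @sum_expr_le _ q 0 i.+1 q01 isT; rewrite expr0 mul1r; apply: le_trans.
  rewrite mulr_natl -[X in _ *+ X](subn0 i.+1) -sumr_const_nat.
  rewrite !big_nat; apply: ler_sum => k /= ki.
  by rewrite ler_wiXn2l// ltW.
exists (K * (1 - q)^-1), t; split; first by rewrite mulr_ge0// invr_ge0 subr_ge0 ltW.
  by rewrite (ltW t0).
move=> i; have sE : s ^+ i = q ^+ i * t ^+ i.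
  by rewrite -exprMn /q divfK// gt_eqF.
rewrite exprS -mulrA; apply: (@le_trans _ _ (i.+1%:R * (K * s ^+ i))).
  by rewrite ler_wpM2l.
rewrite sE (_ : _ * _ = K * (i.+1%:R * q ^+ i) * t ^+ i); last by ring.
by rewrite ler_wpM2r ?exprn_ge0 ?(ltW t0)// ler_wpM2l.
Qed.

(** * Partial sums of the basis as negative binomial distribution polynomials *)

(** Passing from [n] to [n.+1] multiplies the binomial by [(n.+1 + k) / n.+1], which is at most
    [k.+1]. *)
Lemma bin_addn_le (n k : nat) : ('C(n + k, k) <= k.+1 ^ n)%N.
Proof.
elim: n => [|n IH]; first by rewrite add0n binn.
rewrite expnS -(leq_pmul2l (ltn0Sn n)).
have := mul_bin_diag (n.+1 + k) n; rewrite -[in 'C(n.+1 + k, n.+1)]bin_sub ?leq_addr//.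
rewrite addKn addSn /= -[in 'C(n + k, n)]bin_sub ?leq_addr// addKn => <-.
rewrite mulnA leq_mul//; nia.
Qed.

(* The index is shifted: this is the distribution polynomial of [b_{n+1,k}]. *)
Definition negbin_cdf_poly (R : realType) (n N : nat) : {poly R} :=
  \sum_(0 <= k < N) 'C(n + k, k)%:R *: ('X^k * (1 - 'X) ^+ n.+1).

(** The derivative telescopes: that of each added term has one piece cancelling the derivative so
    far and one that becomes the new derivative. *)
Lemma deriv_negbin_cdf_poly (R : realType) (n N : nat) :
  (negbin_cdf_poly R n N.+1)^`() =
  - (N.+1 * 'C(n + N.+1, N.+1))%:R *: ('X^N * (1 - 'X) ^+ n).
Proof.
have d1 : (1 - 'X : {poly R})^`() = -1 by rewrite derivB derivC derivX sub0r.
elim: N => [|N IH].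
  rewrite /negbin_cdf_poly big_nat1 addn0 bin0 scale1r expr0 !mul1r deriv_exp d1.
  by rewrite addn1 bin1 mul1n /= scaleNr scaler_nat mulN1r mulNrn.
rewrite /negbin_cdf_poly big_nat_recr//= -/(negbin_cdf_poly R n N.+1) derivD IH.
have -> : (N.+2 * 'C(n + N.+2, N.+2) = (n + N.+2) * 'C(n + N.+1, N.+1))%N.
  by rewrite -mul_bin_diag !addnS.
rewrite derivZ derivM derivXn deriv_exp d1 /= !scaleNr !scaler_nat.
rewrite !mulrnA !exprS !addnS; ring.
Qed.

(** Mean value theorem: at the intermediate point [c <= r], the coefficient gives the power of
    [N.+2], [c ^+ N] gives [r ^+ N], and the rest lies in the unit interval. *)
Lemma negbin_cdf_poly_decr (R : realType) (n N : nat) (u v r : R) :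
  0 <= u -> u <= v -> v <= r -> r < 1 ->
  0 <= (negbin_cdf_poly R n N.+1).[u] - (negbin_cdf_poly R n N.+1).[v]
    <= N.+2%:R ^+ n.+1 * r ^+ N.
Proof.
move=> u0 uv vr r1; set P := negbin_cdf_poly R n N.+1.
have [|c] := @MVT_segment R (horner P) (horner P^`()) u v uv.
  by apply: derivable_within_continuous => z _; exact: derivable_horner.
rewrite in_itv /= => /andP[uc cv].
rewrite deriv_negbin_cdf_poly hornerZ hornerM !horner_exp.
rewrite hornerD hornerN hornerC hornerX => Pvu.
have -> : P.[u] - P.[v] =
    (N.+1 * 'C(n + N.+1, N.+1))%:R * (c ^+ N * ((1 - c) ^+ n * (v - u))).
  by rewrite -[LHS]opprB Pvu; ring.
have c01 : 0 <= c <= 1 by lra.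
have e0 : 0 <= (1 - c) ^+ n * (v - u) by rewrite mulr_ge0 ?exprn_ge0//; lra.
have e1 : (1 - c) ^+ n * (v - u) <= 1.
  by rewrite mulr_ile1 ?exprn_ge0 ?exprn_ile1//; lra.
have cN0 : 0 <= c ^+ N by rewrite exprn_ge0//; lra.
rewrite mulr_ge0 ?(mulr_ge0 cN0 e0)//=.
apply: ler_pM; rewrite ?(mulr_ge0 cN0 e0)//.
  rewrite -natrX ler_nat expnS leq_mul// ?leqW//.
  exact: bin_addn_le.
apply: (@le_trans _ _ (c ^+ N)); first by rewrite ler_piMr.
by rewrite lerXn2r ?nnegrE//; lra.
Qed.

Lemma baskakov_horner (R : realType) (n k : nat) (x : R) : 0 <= x ->
  baskakov n.+1 k x =
  'C(n + k, k)%:R * ((x / (1 + x)) ^+ k * (1 - x / (1 + x)) ^+ n.+1).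
Proof.
move=> x0; have x1 : 1 + x != 0 by rewrite gt_eqF// ltr_pwDl.
rewrite /baskakov addSn subn1 /=; congr (_ * _).
have -> : 1 - x / (1 + x) = (1 + x)^-1.
  by apply: (mulIf x1); rewrite mulrBl divfK// mulVf// mul1r addrK.
by rewrite expr_div_n exprVn -addSn addnC exprD -mulrA -invfM.
Qed.

Lemma series_baskakov (R : realType) (n N : nat) (x : R) : 0 <= x ->
  series (fun k => baskakov n.+1 k x) N = (negbin_cdf_poly R n N).[x / (1 + x)].
Proof.
move=> x0; rewrite /series /= /negbin_cdf_poly horner_sum.
by apply: eq_bigr => k _; rewrite baskakov_horner// !hornerE.
Qed.

(** * Convexity and growth at the integers *)

Lemma convex_second_difference_ge0 (R : realType) (f : R -> R) (x : R) :
  convex_function (`[0, +oo[%classic : set R) f -> 0 <= x ->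
  0 <= f x - 2 * f (x + 1) + f (x + 2).
Proof.
move=> f_cvx x0.
have h0 : (0 : R) <= 2^-1 by rewrite invr_ge0.
have h1 : (2^-1 : R) <= 1 by lra.
have := f_cvx (Itv01 h0 h1) x (x + 2).
rewrite !inE /= !in_itv /= !andbT => /(_ x0 (addr_ge0 x0 (ler0n _ 2))).
have E : conv (Itv01 h0 h1) (x : R^o) (x + 2) = x + 1.
  by rewrite convRE /= /unstable.onem; field.
rewrite [leRHS]convRE /= /unstable.onem => fx.
have : f (x + 1) <= 2^-1 * f x + (1 - 2^-1) * f (x + 2) by rewrite -E; exact: fx.
by lra.
Qed.

(** Since [1 + i + j <= i.+1 * j.+1], the growth bound splits into one weight per index. *)
Lemma polynomial_growth_addn (R : realType) (f : R -> R) (C : R) (m : nat) :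
  0 <= C -> (forall t, 0 <= t -> `|f t| <= C * (1 + t) ^+ m) ->
  forall i j, `|f (i + j)%:R| <= C * i.+1%:R ^+ m * j.+1%:R ^+ m.
Proof.
move=> C0 fC i j; apply: (le_trans (fC _ (ler0n _ _))).
rewrite -mulrA ler_wpM2l// -exprMn -natrM nat1r lerXn2r ?nnegrE// ler_nat; nia.
Qed.

(** * The abstract inequality applied to the Baskakov basis *)

Theorem theorem6 (R : realType) (n : nat) (hn : (0 < n)%N) (f : R -> R)
    (f_cont : {within `[0, +oo[%classic, continuous f})
    (f_convex : convex_function (`[0, +oo[%classic : set R) f)
    (f_growth : polynomial_growth f)
    (x y : R) (hx : 0 <= x) (hy : 0 <= y) :
  iterated_summable (baskakov_term n f x y) /\
  0 <= iterated_sum (baskakov_term n f x y).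
Proof.
have [C [m [C0 _ fC]]] := f_growth.
case: n hn => // n _.
have u01 (z : R) : 0 <= z -> 0 <= z / (1 + z) < 1.
  move=> z0; have z1 : 0 < 1 + z by rewrite ltr_pwDl.
  apply/andP; split; first by rewrite divr_ge0// ltW.
  by rewrite ltr_pdivrMr// mul1r ltrDr.
set u := x / (1 + x); set v := y / (1 + y).
have /andP[u0 u1] : 0 <= u < 1 := u01 x hx.
have /andP[v0 v1] : 0 <= v < 1 := u01 y hy.
(* A common rate for both points; [r] is kept positive, even if [u = v = 0], to allow division by
   it. *)
have [r [ur vr r0 r1]] : exists r : R, [/\ u <= r, v <= r, 0 < r & r < 1].
  have [uv|/ltW vu] := leP u v.
    by exists ((1 + v) / 2); split; lra.
  by exists ((1 + u) / 2); split; lra.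
pose w i : R := i.+1%:R ^+ m.
(* The exponent adds [n.+1] from the bound on [D] to [m] from the weight [w]. *)
have [K [s [K0 s01 Ks]]] : exists K s : R, [/\ 0 <= K, 0 <= s < 1 &
    forall i, i.+1%:R ^+ (n.+1 + m) * r ^+ i <= K * s ^+ i].
  by apply: natr_exp_geometric; rewrite (ltW r0).
(* The bound on [D N.+1] has only [r ^+ N], one power short, hence the constant [K / r]; the basis
   terms are relaxed to share it. *)
have KrK i : K * s ^+ i <= K / r * s ^+ i.
  have /andP[s0 _] := s01.
  by rewrite ler_wpM2r ?exprn_ge0// ler_peMr// invf_ge1// ltW.
have bK (z : R) : 0 <= z -> z / (1 + z) <= r ->
    forall i, `|baskakov n.+1 i z| * w i <= K / r * s ^+ i.
  move=> z0 zr i; have /andP[t0 t1] := u01 z z0.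
  apply: (le_trans _ (KrK i)); apply: (le_trans _ (Ks i)).
  rewrite baskakov_horner//; set t := z / (1 + z) in zr t0 t1 *.
  have t1' : 0 <= 1 - t by rewrite subr_ge0 ltW.
  rewrite ger0_norm; last by rewrite !mulr_ge0// exprn_ge0.
  rewrite exprD -/(w i) [leRHS]mulrAC ler_wpM2r ?exprn_ge0//.
  apply: ler_pM => //; first by rewrite mulr_ge0// exprn_ge0.
    rewrite -natrX ler_nat (leq_trans (bin_addn_le n i))// leq_pexp2l//.
  apply: (@le_trans _ _ (t ^+ i)).
    by rewrite ler_piMr ?exprn_ge0// exprn_ile1//; lra.
  by rewrite lerXn2r ?nnegrE// ltW.
pose a i := baskakov n.+1 i x; pose b i := baskakov n.+1 i y.
pose D := series (fun i => a i - b i).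
have DE N : D N = (negbin_cdf_poly R n N).[u] - (negbin_cdf_poly R n N).[v].
  by rewrite -!series_baskakov// /D /series /= sumrB.
have D0 : D 0%N = 0 by rewrite /D /series /= big_geq.
have DK N : `|D N| * w N <= K / r * s ^+ N.
  case: N => [|N].
    by rewrite D0 normr0 mul0r mulr_ge0 ?exprn_ge0 ?divr_ge0 ?(ltW r0)//; case/andP: s01.
  have H : `|D N.+1| <= N.+2%:R ^+ n.+1 * r ^+ N.
    rewrite DE; have [uv|/ltW vu] := leP u v.
      by have /andP[? ?] := negbin_cdf_poly_decr n N u0 uv vr r1; rewrite ger0_norm.
    rewrite distrC.
    by have /andP[? ?] := negbin_cdf_poly_decr n N v0 vu ur r1; rewrite ger0_norm.
  apply: (@le_trans _ _ (N.+2%:R ^+ n.+1 * r ^+ N * w N.+1)).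
    by rewrite ler_wpM2r ?exprn_ge0.
  rewrite -(ler_pM2l r0).
  have -> : r * (K / r * s ^+ N.+1) = K * s ^+ N.+1.
    by field; rewrite gt_eqF.
  have -> : r * (N.+2%:R ^+ n.+1 * r ^+ N * w N.+1) =
      N.+2%:R ^+ (n.+1 + m) * r ^+ N.+1.
    by rewrite exprD (exprS r) -/(w N.+1); ring.
  exact: Ks.
(* The sign of [D] depends only on the order of [u] and [v], not on the index. *)
have DD i j : 0 <= D i * D j.
  case: i => [|i]; first by rewrite D0 mul0r.
  case: j => [|j]; first by rewrite D0 mulr0.
  rewrite !DE; have [uv|/ltW vu] := leP u v.
    have /andP[? _] := negbin_cdf_poly_decr n i u0 uv vr r1.
    have /andP[? _] := negbin_cdf_poly_decr n j u0 uv vr r1.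
    exact: mulr_ge0.
  rewrite -mulrNN !opprB.
  have /andP[? _] := negbin_cdf_poly_decr n i v0 vu ur r1.
  have /andP[? _] := negbin_cdf_poly_decr n j v0 vu ur r1.
  exact: mulr_ge0.
apply: (@iterated_sum_square_ge0 R a b (fun i => f i%:R) w C (K / r) s) => //.
- by move=> i; rewrite exprn_ge0.
- by move=> i; rewrite lerXn2r ?nnegrE// ler_nat.
- exact: bK.
- exact: bK.
- exact: polynomial_growth_addn.
- move=> i; have := convex_second_difference_ge0 f_convex (ler0n R i).
  by rewrite natr1 -natrD addn2.
Qed.
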